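(* Let $L$ be a transitive permutation group of degree $6$ that is imprimitive but does not admit a system of imprimitivity consisting of two blocks. Then $L$ is $f$-graph-unrestrictive, where $f(n)=4^{\sqrt{n/3}-1}$.
   Context: All graphs are finite, simple and connected. A pair $(\Gamma,G)$ with $G\le\mathrm{Aut}(\Gamma)$ is locally-$L$ if $G$ is transitive on the arcs of $\Gamma$ and the permutation group induced by the vertex-stabiliser $G_v$ on the neighbourhood $\Gamma(v)$ is permutation isomorphic to $L$. For $f:\mathbb N\to\mathbb R$, a transitive permutation group $L$ is $f$-graph-unrestrictive if for every integer $n$ there exists a locally-$L$ pair $(\Gamma,G)$ with $|\mathrm V(\Gamma)|\ge n$ and $|G_{uv}|\ge f(|\mathrm V(\Gamma)|)$ for an arc $(u,v)$ of $\Gamma$. *)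

(* Defs.v *)
From HB Require Import structures.
From mathcomp Require Import all_boot all_order all_algebra all_fingroup all_solvable.
From mathcomp Require Import reals exp.

Set Implicit Arguments.
Unset Strict Implicit.
Unset Printing Implicit Defensive.

Import Order.TTheory GRing.Theory Num.Theory.

Local Open Scope group_scope.

Record cgraph := CGraph {
  vertex :> finType;
  adj : rel vertex;
  adj_sym : symmetric adj;
  adj_irrefl : irreflexive adj;
  adj_connected : forall x y, connect adj x y }.

Definition graph_aut (Gam : cgraph) : {set {perm Gam}} :=
  [set s : {perm Gam} | [forall x, forall y, adj (s x) (s y) == adj x y]].

Definition arc_transitive (Gam : cgraph) (G : {group {perm Gam}}) : Prop :=
  forall u v x y : Gam, adj u v -> adj x y ->
    exists2 g : {perm Gam}, g \in G & g u = x /\ g v = y.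

Definition nbhd (Gam : cgraph) (v : Gam) : finType := {x : Gam | adj v x}.

(* The domain of the restricted action ['P^?] is the setwise stabiliser of the
   neighbourhood of [v]; it contains the whole of ['C_G[v | 'P]] as soon as [G]
   consists of automorphisms. *)
Definition local_group (Gam : cgraph) (G : {group {perm Gam}}) (v : Gam) :
    {group {perm nbhd v}} :=
  (actperm ('P^? : action _ (nbhd v)) @* 'C_G[v | 'P])%G.

Definition perm_isomorphic (X Y : finType)
    (A : {group {perm X}}) (B : {group {perm Y}}) : Prop :=
  exists (phi : X -> Y) (psi : {morphism A >-> {perm Y}}),
    [/\ bijective phi, isom A B psi
      & forall (a : {perm X}) (x : X), a \in A -> phi (a x) = psi a (phi x)].

Definition is_locally (Omega : finType) (L : {group {perm Omega}})
    (Gam : cgraph) (G : {group {perm Gam}}) : Prop :=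
  [/\ G \subset graph_aut Gam, arc_transitive G
    & forall v : Gam, perm_isomorphic (local_group G v) L].

Definition graph_unrestrictive (R : realType) (f : nat -> R)
    (Omega : finType) (L : {group {perm Omega}}) : Prop :=
  forall n : nat, exists (Gam : cgraph) (G : {group {perm Gam}}),
    [/\ is_locally L G, (n <= #|Gam|)%N
      & exists u v : Gam, adj u v
          /\ (f #|Gam| <= #|'C_G[u | 'P] :&: 'C_G[v | 'P]|%:R)%R].

(* Main.v *)
Require Import Defs.
From HB Require Import structures.
From mathcomp Require Import all_boot all_order all_algebra all_fingroup all_solvable.
From mathcomp Require Import boolp reals exp.
From mathcomp Require Import ring.

(** L permutes three blocks of size 2, so it embeds in C_2 wr S_3; absence of a
system of two blocks forces L to contain the group E of all even flips of the
blocks. Let Lambda be the honeycomb graph on the torus A = Z_{3j} x Z_j with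
j = 2^k: a black and a white copy of A, the black x being joined to the white
x + a_0, x + a_1, x + a_2, where a_0 = (0,0), a_1 = (1,0), a_2 = (2,1). Doubling
every vertex gives a 6-valent graph with 12 j^2 vertices whose arcs are labelled
by the points of L, and G consists of the permutations acting on the labels
around every vertex as elements of L. Every permutation of {a_0, a_1, a_2} is
induced by an affine map of A, so that a rotation or reflection about a vertex,
combined with flips, realises any prescribed element of L locally.

A function f : V(Lambda) -> F_2 with zero sum over every neighbourhood gives an
element of G flipping the pairs where f = 1. On each colour class the condition
is a Pascal-type recurrence between consecutive rows, each row being a function
on Z_{3j}. As j is a power of 2, the Frobenius map shows that a row r returns to
itself after j steps as soon as r(u) + r(u - j) + r(u - 2j) = 0. Thus each class
carries 2^{2j} such functions, and 4^{2j-1} pairs of them vanish at both ends of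
an arc: exactly the required bound for n = 12 j^2. *)

Set Implicit Arguments.
Unset Strict Implicit.
Unset Printing Implicit Defensive.

Import Order.TTheory GRing.Theory Num.Theory.

Local Open Scope group_scope.

(** * Groups with prescribed local action *)

Section UniversalGroup.

Variables (Omega V : finType) (nbr : V -> Omega -> V) (L : {group {perm Omega}}).

Definition acts_locally (g : {perm V}) (v : V) (l : {perm Omega}) : bool :=
  [forall d, g (nbr v d) == nbr (g v) (l d)].

Implicit Types (g h : {perm V}) (v : V) (l m : {perm Omega}).

Lemma acts_locallyP g v l :
  reflect (forall d, g (nbr v d) = nbr (g v) (l d)) (acts_locally g v l).
Proof. exact: 'forall_eqP. Qed.

Lemma acts_locallyM g h v l m :
  acts_locally g v l -> acts_locally h (g v) m -> acts_locally (g * h) v (l * m).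
Proof.
move=> /acts_locallyP gl /acts_locallyP hm.
by apply/acts_locallyP => d; rewrite !permM gl hm.
Qed.

Lemma acts_locallyV g v l :
  acts_locally g v l -> acts_locally g^-1 (g v) l^-1.
Proof.
move=> /acts_locallyP gl; apply/acts_locallyP => d.
by apply: (@perm_inj _ g); rewrite permKV permK gl permKV.
Qed.

(** A finite analogue of the Burger-Mozes universal group: the local action at every vertex, read in
    the labels, is required to lie in [L]. *)
Definition universal_set : {set {perm V}} :=
  [set g | [forall v, [exists l in L, acts_locally g v l]]].

Lemma universalP g :
  reflect (forall v, exists2 l, l \in L & acts_locally g v l)
          (g \in universal_set).
Proof.
rewrite inE; apply: (iffP forallP) => gP v.
  by have /exists_inP[l Ll gl] := gP v; exists l.
by apply/exists_inP; have [l Ll gl] := gP v; exists l.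
Qed.

Lemma universal_group_set : group_set universal_set.
Proof.
apply/group_setP; split.
  apply/universalP => v; exists 1; first exact: group1.
  by apply/acts_locallyP => d; rewrite !perm1.
move=> g h /universalP gP /universalP hP; apply/universalP => v.
have [[l Ll gl] [m Lm hm]] := (gP v, hP (g v)).
by exists (l * m); [exact: groupM | exact: acts_locallyM].
Qed.

Canonical universal_group := Group universal_group_set.

End UniversalGroup.

Section ConjugatePerm.

Variables (X Y : finType) (phi : X -> Y) (psi : Y -> X).
Hypotheses (phiK : cancel phi psi) (psiK : cancel psi phi).

Definition transport (a : {perm X}) : {perm Y} :=
  perm (inj_comp (can_inj phiK) (inj_comp (@perm_inj _ a) (can_inj psiK))).

Lemma transportE a x : transport a (phi x) = phi (a x).
Proof. by rewrite permE /= phiK. Qed.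

Lemma transportM : {in setT &, {morph transport : a b / a * b}}.
Proof.
move=> a b _ _; apply/permP => y.
by rewrite -(psiK y) permM !transportE permM.
Qed.

Lemma transport_inj : injective transport.
Proof.
move=> a b eq_ab; apply/permP => x.
by apply: (can_inj phiK); rewrite -!transportE eq_ab.
Qed.

Lemma perm_isomorphic_transport (A : {group {perm X}}) (B : {group {perm Y}}) :
  transport @: A = B -> perm_isomorphic A B.
Proof.
move=> AB.
exists phi, (restrm_morphism (subsetT A) (Morphism transportM)); split.
- by exists psi.
- apply/isomP; split; first by apply/injmP => a b _ _ /transport_inj.
  by rewrite morphimEdom.
- by move=> a x _; rewrite /= transportE.
Qed.

End ConjugatePerm.

(** * Local action and arc-transitivity of the universal group *)

Section LocalAction.

Variables (Omega : finType) (L : {group {perm Omega}}) (Gam : cgraph).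
Variable nbr : Gam -> Omega -> Gam.
Hypothesis nbr_inj : forall v, injective (nbr v).
Hypothesis adjE : forall v w, adj v w = [exists d, nbr v d == w].

Let G := [group of universal_set nbr L].

Lemma adj_nbr v d : adj v (nbr v d).
Proof. by rewrite adjE; apply/existsP; exists d. Qed.

Lemma universal_graph_aut : universal_set nbr L \subset graph_aut Gam.
Proof.
apply/subsetP => g /universalP gP.
rewrite inE; apply/forallP => x; apply/forallP => y; apply/eqP.
have [l _ /acts_locallyP gl] := gP x; rewrite !adjE.
apply/existsP/existsP => [[d /eqP dy]|[d /eqP <-]].
  exists (l^-1 d); apply/eqP; apply: (@perm_inj _ g).
  by rewrite gl permKV.
by exists (l d); rewrite gl.
Qed.

Hypothesis realize : forall v w l, l \in L ->
  exists2 g, g \in universal_set nbr L & g v = w /\ acts_locally nbr g v l.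

Lemma universal_arc_transitive :
  [transitive L, on [set: Omega] | 'P] -> arc_transitive G.
Proof.
move=> trL u v x y; rewrite !adjE => /existsP[d /eqP <-] /existsP[e /eqP <-].
have [l Ll ->] := atransP2 trL (in_setT d) (in_setT e).
have [g Gg [gu /acts_locallyP gl]] := realize u x Ll.
by exists g => //; rewrite gl gu.
Qed.

(** The labels identify [nbhd v] with [Omega]. An element fixing [v] then acts as its local
    permutation, which lies in [L], and [realize] from [v] to [v] produces all of [L]. *)
Lemma universal_local_group v : perm_isomorphic (local_group G v) L.
Proof.
pose psi (d : Omega) : nbhd v := Sub (nbr v d) (adj_nbr v d).
have psi_inj : injective psi by move=> d e /(congr1 val) /nbr_inj.
have psi_surj (x : nbhd v) : exists d, psi d == x.
  have := valP x; rewrite adjE => /existsP[d dx].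
  by exists d; rewrite -val_eqE.
pose phi x := xchoose (psi_surj x).
have phiK : cancel phi psi by move=> x; apply/eqP/(xchooseP (psi_surj x)).
have psiK : cancel psi phi by move=> d; apply: psi_inj; rewrite phiK.
apply: (perm_isomorphic_transport (phiK := phiK) (psiK := psiK)).
have GvP g : g \in G -> g v = v -> g \in 'C_G[v | 'P].
  by move=> Gg gv; apply/setIP; split=> //; apply/astab1P.
have domP g : g \in G -> g v = v ->
    g \in subact_dom (fun x => adj v x) 'P.
  move=> Gg gv; have := subsetP universal_graph_aut g Gg.
  rewrite inE => /forallP autg; apply/astabsP => x; rewrite !inE /=.
  by rewrite /aperm -{1}gv; exact/eqP/(forallP (autg v)).
have actE g l : g \in G -> g v = v -> acts_locally nbr g v l ->
    transport phiK psiK (actperm ('P^? : action _ (nbhd v)) g) = l.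
  move=> Gg gv /acts_locallyP gl; apply/permP => d.
  rewrite -[d in LHS]psiK transportE.
  apply: psi_inj; rewrite phiK; apply: val_inj.
  by rewrite actpermE /= val_subact domP //= /aperm gl gv.
apply/setP => l; apply/imsetP/idP => [[a /morphimP[g _ Cg ->] ->]|Ll].
  have /setIP[Gg /astab1P gv] := Cg.
  by have /universalP/(_ v)[m Lm gm] := Gg; rewrite (actE g m).
have [g Gg [gv gl]] := realize v v Ll.
exists (actperm ('P^? : action _ (nbhd v)) g); last by rewrite (actE g l).
by apply: mem_morphim; [exact: domP | exact: GvP].
Qed.

Lemma universal_is_locally :
  [transitive L, on [set: Omega] | 'P] -> is_locally L G.
Proof.
move=> trL; split; first exact: universal_graph_aut.
  exact: universal_arc_transitive.
exact: universal_local_group.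
Qed.

End LocalAction.

(** * Permutations of three blocks of size two *)

Local Notation i0 := (inord 0 : 'I_3).
Local Notation i1 := (inord 1 : 'I_3).
Local Notation i2 := (inord 2 : 'I_3).

Lemma ord3P (i : 'I_3) : [\/ i = i0, i = i1 | i = i2].
Proof.
case: i => [[|[|[|i]]] lt_i] //; [constructor 1|constructor 2|constructor 3];
  by apply: val_inj; rewrite /= inordK.
Qed.

Lemma ordS3E : ((ordS i0 = i1) * (ordS i1 = i2) * (ordS i2 = i0))%type.
Proof. by split; first split; apply: val_inj; rewrite /= !inordK. Qed.

Lemma ord3_eqE :
  ((i0 == i1 = false) * (i0 == i2 = false) * (i1 == i2 = false) *
   (i1 == i0 = false) * (i2 == i0 = false) * (i2 == i1 = false))%type.
Proof. by do !split; rewrite -val_eqE /= !inordK. Qed.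

Local Notation rot3 := (perm (@ordS_inj 3)).

(** The dihedral structure of S_3: if [p] is not a rotation, then [p] and [p * rot3] are both
    reflections, that is, involutions with a fixed point. *)
Lemma perm3P (p : {perm 'I_3}) :
  (exists n, p = rot3 ^+ n) \/
  [/\ exists i, p i = i, forall i, p (p i) = i,
      exists i, rot3 (p i) = i & forall i, rot3 (p (rot3 (p i))) = i].
Proof.
have pE i j : p i = p j -> i = j by apply: perm_inj.
have P3 (P : 'I_3 -> Prop) : P i0 -> P i1 -> P i2 -> forall i, P i.
  by move=> P0 P1 P2 i; case: (ord3P i) => ->.
(* Injectivity leaves six of the 27 value tables, in lexicographic order. *)
case: (ord3P (p i0)) => E0; case: (ord3P (p i1)) => E1;
  case: (ord3P (p i2)) => E2;
  try (by have /eqP := pE i0 i1 (etrans E0 (esym E1)); rewrite ord3_eqE);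
  try (by have /eqP := pE i0 i2 (etrans E0 (esym E2)); rewrite ord3_eqE);
  try (by have /eqP := pE i1 i2 (etrans E1 (esym E2)); rewrite ord3_eqE).
- by left; exists 0%N; apply/permP; apply: P3; rewrite ?E0 ?E1 ?E2 perm1.
- right; split.
  + by exists i0.
  + by apply: (P3 (fun i => p (p i) = i)); rewrite ?E0 ?E1 ?E2 ?E0 ?E1 ?E2.
  + by exists i2; rewrite E2 permE ordS3E.
  + by apply: (P3 (fun i => rot3 (p (rot3 (p i))) = i));
      do !rewrite ?E0 ?E1 ?E2 ?(permE (@ordS_inj 3)) ?ordS3E.
- right; split.
  + by exists i2.
  + by apply: (P3 (fun i => p (p i) = i)); rewrite ?E0 ?E1 ?E2 ?E0 ?E1 ?E2.
  + by exists i1; rewrite E1 permE ordS3E.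
  + by apply: (P3 (fun i => rot3 (p (rot3 (p i))) = i));
      do !rewrite ?E0 ?E1 ?E2 ?(permE (@ordS_inj 3)) ?ordS3E.
- left; exists 1%N; apply/permP.
  by apply: P3; rewrite ?E0 ?E1 ?E2 expg1 permE ordS3E.
- left; exists 2%N; apply/permP.
  by apply: P3; rewrite ?E0 ?E1 ?E2 expgS expg1 permM !permE !ordS3E.
- right; split.
  + by exists i1.
  + by apply: (P3 (fun i => p (p i) = i)); rewrite ?E0 ?E1 ?E2 ?E0 ?E1 ?E2.
  + by exists i0; rewrite E0 permE ordS3E.
  + by apply: (P3 (fun i => rot3 (p (rot3 (p i))) = i));
      do !rewrite ?E0 ?E1 ?E2 ?(permE (@ordS_inj 3)) ?ordS3E.
Qed.

Section Encoding.

Variables (Omega : finType) (lam : Omega -> 'I_3 * bool).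
Hypothesis lam_bij : bijective lam.

(** Coordinates in C_2 wr S_3; a flip is indexed by the block in which the point starts, before [p]
    is applied. *)
Definition encoded_by (l : {perm Omega}) (p : {perm 'I_3}) (c : 'I_3 -> bool) :=
  forall d, lam (l d) = (p (lam d).1, (lam d).2 (+) c (lam d).1).

Lemma encoded_ext l p c c' : c =1 c' -> encoded_by l p c -> encoded_by l p c'.
Proof. by move=> cc' lpc d; rewrite lpc cc'. Qed.

Lemma encodedM l p c m q e : encoded_by l p c -> encoded_by m q e ->
  encoded_by (l * m) (p * q) (fun i => c i (+) e (p i)).
Proof. by move=> lpc mqe d; rewrite permM mqe lpc /= permM addbA. Qed.

Lemma encodedV l p c : encoded_by l p c ->
  encoded_by l^-1 p^-1 (fun i => c (p^-1 i)).
Proof.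
move=> lpc d; have := lpc (l^-1 d); rewrite permKV => ->; rewrite /= permK.
by case: (lam _) => i b /=; rewrite addbK.
Qed.

Lemma encoded1 : encoded_by 1 1 (fun=> false).
Proof. by move=> d; rewrite !perm1 addbF; case: (lam d). Qed.

Lemma encodedX r n : encoded_by r rot3 (fun=> false) ->
  encoded_by (r ^+ n) (rot3 ^+ n) (fun=> false).
Proof.
move=> rP; elim: n => [|n IHn]; first exact: encoded1.
by rewrite !expgS; apply: encoded_ext (encodedM rP IHn).
Qed.

(** The image of [(i, false)] determines [p i] and [c i]; the image of [(i, true)] is then the other
    point of the same block. *)
Lemma encoded_exists (l : {perm Omega}) :
  (forall x y, ((lam (l x)).1 == (lam (l y)).1) = ((lam x).1 == (lam y).1)) ->
  exists p c, encoded_by l p c.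
Proof.
case: lam_bij => mu lamK muK lE.
pose p i := (lam (l (mu (i, false)))).1.
pose c i := (lam (l (mu (i, false)))).2.
have p_inj : injective p by move=> i k /eqP; rewrite /p lE !muK => /eqP.
exists (perm p_inj), c => d; rewrite permE /p /c -{1}[d]lamK.
case: (lam d) => i [] /=; last by case: (lam _).
have /eqP : (lam (l (mu (i, true)))).1 == (lam (l (mu (i, false)))).1.
  by rewrite lE !muK.
have : lam (l (mu (i, true))) != lam (l (mu (i, false))).
  rewrite (inj_eq (can_inj lamK)) (inj_eq perm_inj) (inj_eq (can_inj muK)).
  by rewrite xpair_eqE andbF.
case: (lam _) => k b; case: (lam _) => k' b' /= /[swap] ->.
by rewrite xpair_eqE eqxx; case: b b' => [] [].
Qed.

End Encoding.

(** * Even flips contained in L *)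

Section EvenFlips.

Variables (Omega : finType) (L : {group {perm Omega}}).
Variables (lam : Omega -> 'I_3 * bool) (r : {perm Omega}).
Hypothesis lam_bij : bijective lam.
Hypothesis L_enc : forall l, l \in L -> exists p c, encoded_by lam l p c.
Hypotheses (Lr : r \in L) (r_enc : encoded_by lam r rot3 (fun=> false)).

(** The kernel of the action on blocks, seen as a binary code of length 3: products make it linear,
    conjugation by [r] makes it cyclic. *)
Let K (c : 'I_3 -> bool) := exists2 l, l \in L & encoded_by lam l 1 c.

Let K_ext c c' : c =1 c' -> K c -> K c'.
Proof. by move=> cc' [l Ll lc]; exists l => //; apply: encoded_ext lc. Qed.

Let K_add c c' : K c -> K c' -> K (fun i => c i (+) c' i).
Proof.
move=> [l Ll lc] [m Lm mc]; exists (l * m); first exact: groupM.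
rewrite -[1]mul1g; apply: encoded_ext (encodedM lc mc) => i.
by rewrite perm1.
Qed.

Let K_rot c : K c -> K (c \o @ordS 3).
Proof.
move=> [l Ll lc]; exists (r * l * r^-1); first by rewrite !groupM ?groupV.
rewrite -(mulgV rot3) -{1}[rot3]mulg1.
apply: encoded_ext (encodedM (encodedM r_enc lc) (encodedV r_enc)) => i.
by rewrite /= addbF permE.
Qed.

Let constant (c : 'I_3 -> bool) := forall i, c (ordS i) = c i.

Let constantE c : constant c -> forall i, c i = c i0.
Proof.
move=> cc; have c1 : c i1 = c i0 by rewrite -(cc i0) ordS3E.
have c2 : c i2 = c i1 by rewrite -(cc i1) ordS3E.
by move=> i; case: (ord3P i) => ->; rewrite ?c2 ?c1.
Qed.

(** A rotation reduces to the kernel after division by a power of [r]. For a reflection [p], the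
    square of [l] has flip [c i (+) c (p i)], which is constant and zero at a fixed point, so [c] is
    invariant under [p]. The same argument for [l * r] makes [c] invariant under [p * rot3], hence
    under [rot3]. *)
Let encoded_constant : (forall c, K c -> constant c) ->
  forall l p c, l \in L -> encoded_by lam l p c -> constant c.
Proof.
move=> Kc l p c Ll lc; case: (perm3P p) => [[n pE]|[[i pi] pp [k pk] rprp]].
  apply: Kc; exists (l * (r ^+ n)^-1); first by rewrite !(groupM, groupV, groupX).
  rewrite pE in lc; rewrite -(mulgV (rot3 ^+ n)).
  have re := encodedV (encodedX n r_enc).
  by apply: encoded_ext (encodedM lc re) => i; rewrite /= addbF.
have inv m q e : m \in L -> encoded_by lam m q e ->
    (exists i, q i = i) -> (forall i, q (q i) = i) -> forall i, e i = e (q i).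
  move=> Lm me [h qh] qq x.
  have Ke : K (fun i => e i (+) e (q i)).
    exists (m * m); first exact: groupM.
    have <- : q * q = 1 by apply/permP => y; rewrite permM perm1 qq.
    exact: encodedM.
  have eE y : e y (+) e (q y) = e i0 (+) e (q i0) := constantE (Kc _ Ke) y.
  by have := eE x; rewrite -(eE h) qh addbb; case: (e x) (e (q x)) => [] [].
have c1 := inv l p c Ll lc (ex_intro _ i pi) pp.
have c2 x : c x = c (rot3 (p x)).
  rewrite -permM; apply: (inv (l * r) (p * rot3) c).
  - exact: groupM.
  - by apply: encoded_ext (encodedM lc r_enc) => y; rewrite addbF.
  - by exists k; rewrite permM.
  - by move=> y; rewrite !permM.
by move=> x; rewrite -(pp x) -c1 [in RHS]c2 permE.
Qed.

(** With constant flips only, every element of [L] preserves or exchanges the two layers given by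
    the second coordinate. *)
Let two_blocks : (forall c, K c -> constant c) ->
  exists Q : {set {set Omega}},
    imprimitivity_system L [set: Omega] 'P Q /\ #|Q| = 2.
Proof.
move=> Kc; have [mu lamK muK] := lam_bij.
pose B b := [set x | (lam x).2 == b].
have Bmu b : mu (i0, b) \in B b by rewrite inE muK.
have B_inj : injective B.
  by move=> b b' BB; have := Bmu b; rewrite BB inE muK => /eqP.
pose Q := [set B b | b : bool].
have Q2 : #|Q| = 2 by rewrite card_imset // card_bool.
exists Q; split=> //; apply/and3P; split; last first.
- by rewrite Q2 cardsT (bij_eq_card lam_bij) card_prod card_ord card_bool.
- apply/subsetP => l Ll; rewrite !inE /=.
  apply/subsetP => X /imsetP[b _ ->]; rewrite inE.
  have [p [c lc]] := L_enc Ll.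
  have cE := constantE (encoded_constant Kc Ll lc).
  apply/imsetP; exists (b (+) c i0) => //; apply/setP => y.
  apply/imsetP/idP => [[x]|]; rewrite !inE.
    by move=> /eqP <- ->; rewrite /= /aperm lc /= cE.
  move=> /eqP yb; exists (l^-1 y); last by rewrite /= /aperm permKV.
  rewrite inE; have := lc (l^-1 y); rewrite permKV => /(congr1 snd) /=.
  by rewrite yb cE => /addIb ->.
- apply/and3P; split.
  + apply/eqP/setP => x; rewrite inE; apply/bigcupP; exists (B (lam x).2).
      exact: imset_f.
    by rewrite inE.
  + apply/trivIsetP => _ _ /imsetP[b _ ->] /imsetP[b' _ ->].
    rewrite (inj_eq B_inj) => bb'; apply/pred0P => x; rewrite /= !inE.
    by apply/negP => /andP[/eqP xb /eqP xb']; rewrite -xb -xb' eqxx in bb'.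
  + by apply/imsetP => -[b _ /setP /(_ (mu (i0, b)))]; rewrite Bmu inE.
Qed.

(** Without two blocks the kernel contains a nonconstant [c]. The sum of [c] and its rotation has
    weight two, and its own rotations are all the nonzero even flips. *)
Lemma even_flips :
  ~ (exists Q : {set {set Omega}},
      imprimitivity_system L [set: Omega] 'P Q /\ #|Q| = 2) ->
  forall c : 'I_3 -> bool, c i0 (+) c i1 (+) c i2 = false ->
  exists2 l, l \in L & encoded_by lam l 1 c.
Proof.
move=> no2.
have [c Kc cP] : exists2 c, K c & (c i0 (+) c i1) || (c i1 (+) c i2).
  apply: contrapT => noc; apply/no2/two_blocks => c Kc.
  have : ~~ ((c i0 (+) c i1) || (c i1 (+) c i2)).
    by apply/negP => cP; apply: noc; exists c.
  move=> cP i; case: (ord3P i) => ->; rewrite ordS3E;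
    by case: (c i0) (c i1) (c i2) cP => [] [] [].
have Kc1 := K_rot Kc; have Kc2 := K_rot Kc1.
have Kd := K_add Kc Kc1; have Kd1 := K_add Kc1 Kc2; have Kd2 := K_add Kc2 Kc.
have K0 := K_add Kc Kc.
move=> e eP.
have E c' : K c' -> (c' i0 == e i0) && (c' i1 == e i1) && (c' i2 == e i2) -> K e.
  move=> Kc' /andP[/andP[/eqP e0 /eqP e1] /eqP e2].
  by apply: K_ext Kc' => i; case: (ord3P i) => ->.
move: (E _ K0) (E _ Kd) (E _ Kd1) (E _ Kd2); rewrite /= !ordS3E.
move: cP eP; case: (c i0) (c i1) (c i2) => [] [] [] //=;
  case: (e i0) (e i1) (e i2) => [] [] [] //= _ _ H0 H1 H2 H3;
  by [exact: H0 | exact: H1 | exact: H2 | exact: H3].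
Qed.

End EvenFlips.

(** * Coordinates from the block system *)

Section Blocks.

Variables (Omega : finType) (L : {group {perm Omega}}) (Q : {set {set Omega}}).
Hypothesis trL : [transitive L, on [set: Omega] | 'P].
Hypothesis partQ : partition Q [set: Omega].
Hypothesis actsQ : [acts L, on Q | 'P^*].

Lemma block_image l x : l \in L -> pblock Q (l x) = [set l y | y in pblock Q x].
Proof.
move=> Ll; have /and3P[/eqP covQ tiQ _] := partQ.
have Qx z : pblock Q z \in Q by rewrite pblock_mem // covQ inE.
have Qlx : [set l y | y in pblock Q x] \in Q.
  by have := acts_act actsQ Ll (pblock Q x); rewrite Qx.
apply: (def_pblock tiQ Qlx); apply: imset_f.
by rewrite mem_pblock covQ inE.
Qed.

Lemma block_eq l x y : l \in L ->
  (pblock Q (l x) == pblock Q (l y)) = (pblock Q x == pblock Q y).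
Proof.
by move=> Ll; rewrite !block_image // (inj_eq (imset_inj perm_inj)).
Qed.

Lemma card_block x : #|Omega| = (#|Q| * #|pblock Q x|)%N.
Proof.
have /and3P[/eqP covQ tiQ _] := partQ.
rewrite -cardsT; apply: card_uniform_partition (partQ) => B QB.
have /set0Pn[y By] : B != set0.
  by apply: contraTneq QB => ->; have /and3P[] := partQ.
have [l Ll yE] := atransP2 trL (in_setT x) (in_setT y).
by rewrite -(def_pblock tiQ QB By) yE block_image // card_imset //; apply: perm_inj.
Qed.

End Blocks.

(** The number of blocks divides 6 and is not 2, so there are three pairs. An element [r] of order 3
    cannot preserve every pair, so it permutes them cyclically; the [r]-orbits of the two points
    [p], [q] of one pair are the two layers, on which [r] is a pure rotation. *)
Lemma block_coordinates (Omega : finType) (L : {group {perm Omega}}) :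
  #|Omega| = 6 ->
  [transitive L, on [set: Omega] | 'P] ->
  ~~ [primitive L, on [set: Omega] | 'P] ->
  ~ (exists Q : {set {set Omega}},
      imprimitivity_system L [set: Omega] 'P Q /\ #|Q| = 2) ->
  exists (lam : Omega -> 'I_3 * bool) (r : {perm Omega}),
    [/\ bijective lam,
        forall l, l \in L -> forall x y,
          ((lam (l x)).1 == (lam (l y)).1) = ((lam x).1 == (lam y).1),
        r \in L & encoded_by lam r rot3 (fun=> false)].
Proof.
move=> card6 trL; rewrite /primitive trL /= negbK => /existsP[Q imQ] no2.
have := imQ => /and3P[partQ actsQ]; rewrite cardsT card6 => cardQ.
have /and3P[/eqP covQ tiQ _] := partQ.
have cardB x : #|pblock Q x| = 2.
  have E := card_block trL partQ actsQ x; rewrite card6 in E.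
  have dQ : #|Q| %| 6 by rewrite E dvdn_mulr.
  have : #|Q| != 2 by apply/eqP => Q2; apply: no2; exists Q.
  rewrite -[#|pblock Q x|](@mulKn _ #|Q|) -?E; last by case/andP: cardQ => /ltnW.
  by case: #|Q| cardQ dQ => [|[|[|[|[|[|q]]]]]].
have [r Lr r3] : exists2 r, r \in L & #[r] = 3.
  have : 3 %| #|L| by apply: dvdn_trans (atrans_dvd trL); rewrite cardsT card6.
  by case/(Cauchy (isT : prime 3)) => r; exists r.
pose R x y := pblock Q x == pblock Q y.
have Rin : forall x y, R x y = (y \in pblock Q x).
  by move=> x y; rewrite /R eq_pblock // covQ inE.
have RL : forall l x y, l \in L -> R (l x) (l y) = R x y.
  by move=> l x y Ll; apply: (block_eq partQ actsQ).
have rrr x : r (r (r x)) = x.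
  by have := expg_order r; rewrite r3 => /permP/(_ x); rewrite !permM perm1.
have [p Rp] : exists p, ~~ R p (r p).
  apply/existsP; rewrite -negb_forall; apply/negP => /forallP Rr.
  suff r1 : r = 1 by move: r3; rewrite r1 order1.
  apply/permP => x; rewrite perm1; apply/eqP/negPn/negP => rx.
  have : #|[set x; r x; r (r x)]| <= #|pblock Q x|.
    apply/subset_leq_card/subsetP => y; rewrite !inE -Rin.
    case/orP=> [/orP[]|] /eqP->; [exact: eqxx | exact: Rr |].
    by rewrite /R (eqP (Rr x)) (eqP (Rr (r x))).
  rewrite cardB setUC cardsU1 cards2 !inE [x == _]eq_sym (negbTE rx).
  rewrite (inj_eq perm_inj) (negbTE rx) orbF.
  suff /negbTE-> : r (r x) != x by [].
  by apply: contraNneq rx => rrx; rewrite -{2}[x]rrr rrx.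
have [q pq Rq] : exists2 q, p != q & R p q.
  have : 0 < #|pblock Q p :\ p|.
    by have := cardsD1 p (pblock Q p); rewrite cardB -Rin /R eqxx add1n => -[<-].
  by case/card_gt0P=> q; rewrite !inE eq_sym -Rin => /andP[]; exists q.
pose mu (ib : 'I_3 * bool) := (r ^+ ib.1) (if ib.2 then q else p).
have Lri i : r ^+ i \in L by rewrite groupX.
have Rpp : forall i k : 'I_3, R ((r ^+ i) p) ((r ^+ k) p) = (i == k).
  have RR x : R x x by apply: eqxx.
  have R1 : R p (r p) = false by apply: negbTE.
  have R2 : R (r p) (r (r p)) = false by rewrite RL.
  have R3 : R (r (r p)) p = false by rewrite -{2}[p]rrr !RL.
  have Rsym x y : R x y = R y x by rewrite /R eq_sym.
  move=> i k; case: (ord3P i) (ord3P k) => -> [] ->; rewrite ?eqxx ?ord3_eqE;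
    rewrite ?inordK // ?expg0 ?perm1 ?expgS ?expg1 ?mulg1 ?permM;
    by [rewrite RR | rewrite (R1, R2, R3) | rewrite Rsym (R1, R2, R3)].
have Rmu : forall u w, R (mu u) (mu w) = (u.1 == w.1).
  have Rmup u : R (mu u) ((r ^+ u.1) p).
    rewrite RL //; case: u.2; last exact: eqxx.
    by rewrite /R eq_sym.
  by move=> u w; rewrite -Rpp /R (eqP (Rmup u)) (eqP (Rmup w)).
have mu_inj : injective mu.
  move=> u w uw; have /eqP e1 : u.1 == w.1 by rewrite -Rmu uw /R eqxx.
  move: uw; rewrite /mu e1 => /perm_inj; case: u w e1 => [i b] [k c] /= -> e2.
  congr (_, _); case: b c e2 => [] [] // /eqP; last by rewrite (negbTE pq).
  by rewrite eq_sym (negbTE pq).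
have [lam muK lamK] : bijective mu.
  by apply: inj_card_bij => //; rewrite card_prod card_ord card_bool card6.
have lamE x y : ((lam x).1 == (lam y).1) = R x y by rewrite -Rmu !lamK.
exists lam, r; split=> //; first by exists mu.
  by move=> l Ll x y; rewrite !lamE RL.
move=> d; rewrite -{1}[d]lamK; apply: (can_inj muK); rewrite lamK addbF permE.
rewrite /mu /=; case: (lam d) => i b /=.
rewrite -permM -expgSr; case: (ord3P i) => ->; rewrite ?inordK //.
by rewrite -[in LHS]r3 expg_order.
Qed.

Lemma imprimitive_coordinates (Omega : finType) (L : {group {perm Omega}}) :
  #|Omega| = 6 ->
  [transitive L, on [set: Omega] | 'P] ->
  ~~ [primitive L, on [set: Omega] | 'P] ->
  ~ (exists Q : {set {set Omega}},
      imprimitivity_system L [set: Omega] 'P Q /\ #|Q| = 2) ->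
  exists lam : Omega -> 'I_3 * bool,
    [/\ bijective lam,
        forall l, l \in L -> exists p c, encoded_by lam l p c
      & forall c : 'I_3 -> bool, c i0 (+) c i1 (+) c i2 = false ->
        exists2 l, l \in L & encoded_by lam l 1 c].
Proof.
move=> card6 trL impL no2.
have [lam [r [lam_bij lamL Lr rE]]] := block_coordinates card6 trL impL no2.
have L_enc l : l \in L -> exists p c, encoded_by lam l p c.
  by move=> Ll; apply: encoded_exists => //; apply: lamL.
by exists lam; split=> // c; apply: even_flips Lr rE no2 c.
Qed.

(** * The doubled honeycomb graph on a torus *)

Local Open Scope ring_scope.

Lemma mulrn_mod (U : zmodType) (x : U) m n :
  x *+ m = 0 -> x *+ (n %% m) = x *+ n.
Proof.
move=> xm.
by rewrite [in RHS](divn_eq n m) mulrnDr mulnC mulrnA xm mul0rn add0r.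
Qed.

Lemma mulrn_Zp (U : zmodType) (x : U) p (a b : 'Z_p) : (1 < p)%N ->
  x *+ p = 0 -> x *+ (a + b)%R = x *+ a + x *+ b.
Proof. by move=> p_gt1 xp; rewrite /= mulrn_mod ?mulrnDr // Zp_cast. Qed.

Lemma pair_mulrn (U W : zmodType) (x : U) (y : W) n :
  (x, y) *+ n = (x *+ n, y *+ n).
Proof. by elim: n => // n IHn; rewrite !mulrS IHn. Qed.

Section Honeycomb.

Variable j : nat.
Hypothesis j_gt1 : (1 < j)%N.

Local Notation torus := ('Z_(3 * j) * 'Z_j)%type.
Local Notation node := (torus * bool)%type.

Let j3_gt1 : (1 < 3 * j)%N.
Proof. by rewrite (leq_trans j_gt1) // leq_pmull. Qed.

(** Only a_2 changes the second coordinate, which gives a recurrence from row to row; the first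
    coordinates are distinct modulo 3, which [residue] exploits. *)
Definition corner (i : 'I_3) : torus := (i%:R, (i == 2 :> nat)%:R).

Definition step (v : node) (i : 'I_3) : node :=
  if v.2 then (v.1 - corner i, false) else (v.1 + corner i, true).

Lemma stepK v i : step (step v i) i = v.
Proof. by case: v => x [] /=; rewrite /step /= ?subrK ?addrK. Qed.

Lemma corner0 : corner i0 = 0.
Proof. by rewrite /corner inordK. Qed.

Lemma corner2 : corner i2 = corner i1 *+ 2 + (0, 1).
Proof.
by rewrite /corner !inordK // mulr2n; congr pair; rewrite /= ?addr0 ?add0r.
Qed.

Lemma torus_mulrn3j (x : torus) : x *+ (3 * j) = 0.
Proof.
case: x => a b; rewrite pair_mulrn -[a *+ _]mulr_natr pchar_Zp // mulr0.
by rewrite mulnC mulrnA -[b *+ j]mulr_natr pchar_Zp // mulr0 mul0rn.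
Qed.

Section CornerPermutation.

Variable p : {perm 'I_3}.

Let d1 := corner (p i1) - corner (p i0).
Let d2 := corner (p i2) + corner (p i0) - corner (p i1) *+ 2.

(* The affine map sending each [corner i] to [corner (p i)], minus its constant
   term; [(1, 0)] is [a_1 - a_0] and [(0, 1)] is [a_2 + a_0 - 2 a_1]. *)
Definition corner_map (x : torus) : torus := d1 *+ x.1 + d2 *+ x.2.

Lemma sum_corner : corner (p i0) + corner (p i1) + corner (p i2) = (3, 1).
Proof.
have sumE q : corner (q i0) + corner (q i1) + corner (q i2) = \sum_i corner (q i).
  rewrite !big_ord_recr big_ord0 /= add0r; congr (corner (q _) + corner (q _) + corner (q _));
  by apply: val_inj; rewrite /= inordK.
have reE : \sum_i corner i = \sum_i corner (p i) by exact/reindex_inj/perm_inj.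
rewrite (sumE p) -reE -[LHS](sumE id) corner0 add0r corner2 addrA -mulrS.
by rewrite /corner inordK // pair_mulrn; congr pair; rewrite /= ?mul0rn ?addr0 ?add0r.
Qed.

(** Since [d2] is [(3, 1)] minus three times a corner, [j] kills it in both factors. This makes
    [corner_map] additive although its second argument lives modulo [j]. *)
Let d2j : d2 *+ j = 0.
Proof.
have -> : d2 = (3, 1) - corner (p i1) *+ 3.
  rewrite -sum_corner /d2 !mulrS !mulr0n; ring.
rewrite mulrnBl -mulrnA torus_mulrn3j subr0.
rewrite pair_mulrn -mulrnA.
by rewrite !pchar_Zp.
Qed.

Lemma corner_mapD x y : corner_map (x + y) = corner_map x + corner_map y.
Proof.
by rewrite /corner_map !mulrn_Zp ?torus_mulrn3j // addrACA.
Qed.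

Lemma corner_mapB x y : corner_map (x - y) = corner_map x - corner_map y.
Proof. by apply/eqP; rewrite eq_sym subr_eq -corner_mapD subrK. Qed.

Lemma corner_map0 : corner_map 0 = 0.
Proof. by rewrite /corner_map /= !mulr0n addr0. Qed.

Lemma corner_mapMn x n : corner_map (x *+ n) = corner_map x *+ n.
Proof.
elim: n => [|n IHn]; last by rewrite !mulrS corner_mapD IHn.
by rewrite !mulr0n corner_map0.
Qed.

Lemma corner_mapE i : corner_map (corner i) = corner (p i) - corner (p i0).
Proof.
have e1 : corner_map (corner i1) = d1.
  by rewrite /corner_map /corner inordK //= mulr0n addr0.
have e2 : corner_map (0, 1) = d2 by rewrite /corner_map /= mulr0n add0r.
case: (ord3P i) => ->.
- by rewrite corner0 subrr corner_map0.
- by rewrite e1.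
rewrite corner2 corner_mapD corner_mapMn e1 e2 /d1 /d2.
by rewrite !mulrS !mulr0n; ring.
Qed.

End CornerPermutation.

(** The composite is additive and fixes the generators [(1, 0)] and [(0, 1)], both combinations of
    corners. *)
Lemma corner_mapK (p q : {perm 'I_3}) :
  (forall i, q (p i) = i) -> cancel (corner_map p) (corner_map q).
Proof.
move=> qp [u t]; rewrite [corner_map p _]/corner_map /= corner_mapD !corner_mapMn.
rewrite corner_mapB corner_mapB corner_mapD corner_mapMn !corner_mapE !qp.
rewrite corner0 corner2 !mulr2n; set y := corner i1; set z := corner (q i0).
have -> : y - z - (0 - z) = y by ring.
have -> : y + y + (0, 1) - z + (0 - z) - (y - z + (y - z)) = (0, 1) by ring.
by rewrite /y /corner inordK // !pair_mulrn /= !mul0rn; congr pair;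
  rewrite /= ?addr0 ?add0r natr_Zp.
Qed.

Lemma corner_map_inj p : injective (corner_map p).
Proof. by apply: (can_inj (corner_mapK (q := p^-1%g) _)) => i; rewrite permK. Qed.

(** The constant term enters on white vertices only: black 0 stays fixed while its neighbours are
    permuted by [p]. *)
Definition turn (p : {perm 'I_3}) (v : node) : node :=
  (if v.2 then corner_map p v.1 + corner (p i0) else corner_map p v.1, v.2).

Lemma turn_inj p : injective (turn p).
Proof.
move=> [x b] [y c] [] /[swap] ->; case: c => [/addIr|] /corner_map_inj -> //.
Qed.

Lemma turn_step p v i : turn p (step v i) = step (turn p v) (p i).
Proof.
case: v => x []; rewrite /turn /step /=.
  by rewrite corner_mapB corner_mapE; congr pair; ring.
by rewrite corner_mapD corner_mapE; congr pair; ring.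
Qed.

(* [shift true x] is a point reflection exchanging the colours: like the
   translations, it preserves the directions [i]. *)
Definition shift (b : bool) (x : torus) (v : node) : node :=
  if b then (x - v.1, ~~ v.2) else (x + v.1, v.2).

Lemma shift_inj b x : injective (shift b x).
Proof.
case: b => -[y c] [z d] E; have := congr1 fst E; have := congr1 snd E.
  by move=> /negb_inj /= -> /addrI/oppr_inj ->.
by move=> /= -> /addrI ->.
Qed.

Lemma shift_step b x v i : shift b x (step v i) = step (shift b x v) i.
Proof.
by case: v => y []; case: b; rewrite /shift /step /=; congr pair; ring.
Qed.

(* Functions of the residue account for all even flips around a single vertex. *)
Definition residue (x : torus) : nat := x.1 %% 3.

Lemma residueD x y : residue (x + y) = ((residue x + residue y) %% 3)%N.
Proof. by rewrite /residue /= modn_dvdm ?modnDm // Zp_cast // dvdn_mulr. Qed.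

Lemma residue_corner i : residue (corner i) = i.
Proof.
rewrite /residue /corner val_Zp_nat // modn_dvdm ?dvdn_mulr //.
by rewrite modn_small.
Qed.

Lemma step_inj v : injective (step v).
Proof.
move=> i k /(congr1 fst) E; apply: ord_inj; rewrite -!residue_corner.
by congr residue; move: E; rewrite /step; case: v.2 => /addrI // /oppr_inj.
Qed.

Definition balanced (f : node -> bool) :=
  forall v, f (step v i0) (+) f (step v i1) (+) f (step v i2) = false.

Definition periodic (phi : bool -> nat -> bool) (v : node) : bool :=
  phi v.2 (residue v.1).

(** The three neighbours of any vertex have residues 0, 1, 2 in some order. *)
Lemma periodic_balanced phi :
  (forall b, phi b 0%N (+) phi b 1%N (+) phi b 2%N = false) ->
  balanced (periodic phi).
Proof.
move=> phiE [x b]; rewrite /periodic /step; case: b => /=.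
  have E i := residueD (x - corner i) (corner i).
  have := (E i0, E i1, E i2); rewrite !subrK !residue_corner !inordK //.
  have lt3 y : (residue y < 3)%N by rewrite ltn_mod.
  move: (residue x) (lt3 (x - corner i0)) (lt3 (x - corner i1)) (lt3 (x - corner i2)).
  case: (residue (x - corner i0)) => [|[|[|n0]]] // s _;
  case: (residue (x - corner i1)) => [|[|[|n1]]] // _;
  case: (residue (x - corner i2)) => [|[|[|n2]]] // _ [[-> //]] //= _ _;
  have := phiE false;
  by case: (phi _ 0%N) (phi _ 1%N) (phi _ 2%N) => [] [] [].
rewrite !residueD !residue_corner !inordK //.
have : (residue x < 3)%N by rewrite ltn_mod.
case: (residue x) => [|[|[|n]]] // _; have := phiE true;
by case: (phi _ 0%N) (phi _ 1%N) (phi _ 2%N) => [] [] [].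
Qed.

Definition cover_fun (h : node -> node) (f : node -> bool) (w : node * bool) :=
  (h w.1, w.2 (+) f w.1).

Lemma cover_fun_inj h f : injective h -> injective (cover_fun h f).
Proof. by move=> h_inj [v e] [w e'] [/h_inj -> /addIb ->]. Qed.

Definition cover_perm h f (h_inj : injective h) : {perm node * bool} :=
  perm (@cover_fun_inj h f h_inj).

Lemma cover_permE h f (h_inj : injective h) w :
  cover_perm f h_inj w = (h w.1, w.2 (+) f w.1).
Proof. by rewrite permE. Qed.

Definition hadj (v w : node * bool) : bool := [exists i, step v.1 i == w.1].

Lemma hadj_step v i e e' : hadj (v, e) (step v i, e').
Proof. by apply/existsP; exists i. Qed.

Lemma hadj_sym : symmetric hadj.
Proof.
by move=> v w; apply/existsP/existsP => -[i /eqP /= E]; exists i; rewrite -E stepK.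
Qed.

Lemma hadj_irrefl : irreflexive hadj.
Proof.
move=> [[x b] e]; apply/negbTE/existsP => -[i /eqP /(congr1 snd)] /=.
by rewrite /step; case: b.
Qed.

(** Going out in direction [i] and back in direction 0 translates a black vertex by a_i, since a_0 =
    0; the copy reached is arbitrary. *)
Lemma hadj_connected v w : connect hadj v w.
Proof.
have csym := sym_connect_sym hadj_sym.
pose v0 : node * bool := (0, false, false).
suff c0 u : connect hadj v0 u by apply: connect_trans (c0 w); rewrite csym.
have c1 x : connect hadj v0 (x, false, false) -> forall i e,
    connect hadj v0 (x + corner i, true, e).
  move=> cx i e; apply: connect_trans cx (connect1 _).
  by have := hadj_step (x, false) i false e.
have c2 x i : connect hadj v0 (x, false, false) -> forall e,
    connect hadj v0 (x + corner i, false, e).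
  move=> cx e; apply: connect_trans (c1 x cx i false) (connect1 _).
  by have := hadj_step (x + corner i, true) i0 false e; rewrite /step /= corner0 subr0.
have c3 x i n : connect hadj v0 (x, false, false) ->
    connect hadj v0 (x + corner i *+ n, false, false).
  move=> cx; elim: n => [|n IHn]; first by rewrite addr0.
  by rewrite mulrSr addrA; apply: c2.
have c4 x : connect hadj v0 (x, false, false).
  (* The decomposition is x = (x.1 - 2 x.2) a_1 + x.2 a_2. *)
  have := c3 _ i2 x.2 (c3 0 i1 (x.1 - x.2%:R *+ 2)%R (connect0 _ _)).
  congr (connect _ _ (_, _, _)).
  have c1E : corner i1 = (1, 0) by rewrite /corner inordK.
  rewrite add0r corner2 mulrnDl -mulrnA c1E !pair_mulrn natr_Zp.
  case: x => y t; congr pair; rewrite /= !mul0rn ?add0r ?addr0 ?natr_Zp.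
    by rewrite -mulr2n -mulrnA [(2 * _)%N]mulnC subrK.
  by rewrite mul0rn add0r.
case: u => [[x []] e].
  by have := c1 x (c4 x) i0 e; rewrite corner0 addr0.
by have := c2 x i0 (c4 x) e; rewrite corner0 addr0.
Qed.

Definition honeycomb : cgraph :=
  CGraph hadj_sym hadj_irrefl hadj_connected.

Lemma card_honeycomb : #|honeycomb| = (12 * j ^ 2)%N.
Proof.
rewrite /= !card_prod !card_bool !card_ord !Zp_cast //.
by rewrite -mulnn; ring.
Qed.

End Honeycomb.

Local Close Scope ring_scope.

(** * Automorphisms realising every element of L *)

Section UniversalElements.

Variables (Omega : finType) (L : {group {perm Omega}}).
Variables (lam : Omega -> 'I_3 * bool) (j : nat).
Hypothesis lam_bij : bijective lam.
Hypothesis L_enc : forall l, l \in L -> exists p c, encoded_by lam l p c.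
Hypothesis L_even : forall c : 'I_3 -> bool,
  c i0 (+) c i1 (+) c i2 = false -> exists2 l, l \in L & encoded_by lam l 1 c.
Hypothesis j_gt1 : 1 < j.

Local Notation torus := ('Z_(3 * j) * 'Z_j)%type.
Local Notation node := (torus * bool)%type.

Implicit Types (h : node -> node) (f : node -> bool) (v : node) (e : bool).
Implicit Types (l : {perm Omega}) (p : {perm 'I_3}) (c : 'I_3 -> bool).

(** The label names the copy reached in absolute terms, so both copies of a vertex see the same
    labels. *)
Definition hnbr (w : node * bool) (d : Omega) : node * bool :=
  (step w.1 (lam d).1, (lam d).2).

Lemma hnbr_inj w : injective (hnbr w).
Proof.
move=> d e [/(step_inj j_gt1) E1 E2]; apply: (bij_inj lam_bij).
exact: injective_projections.
Qed.

Lemma hadjE (v w : node * bool) : hadj v w = [exists d, hnbr v d == w].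
Proof.
have [mu lamK muK] := lam_bij.
apply/existsP/existsP => [[i /eqP E]|[d /eqP <-]]; last by exists (lam d).1.
exists (mu (i, w.2)); rewrite /hnbr muK /= E.
by case: (w).
Qed.

Lemma cover_acts_locally h f (h_inj : injective h) v e l p :
  (forall i, h (step v i) = step (h v) (p i)) ->
  encoded_by lam l p (fun i => f (step v i)) ->
  acts_locally hnbr (cover_perm f h_inj) (v, e) l.
Proof.
move=> hp le; apply/acts_locallyP => d.
by rewrite !cover_permE /hnbr /= hp le.
Qed.

(** Adding the sum of [c] as a global flip corrects parity: around every vertex the flips then
    differ from [c] by an even flip, and [L] contains all even flips. *)
Lemma cover_universal h f (h_inj : injective h) l p c :
  (forall v i, h (step v i) = step (h v) (p i)) ->
  l \in L -> encoded_by lam l p c -> balanced f ->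
  cover_perm (fun v => (c i0 (+) c i1 (+) c i2) (+) f v) h_inj
    \in universal_set hnbr L.
Proof.
move=> hp Ll lc bf; set s := c i0 (+) _ (+) _; apply/universalP => -[v e].
have [|m Lm me] := @L_even (fun i => c i (+) (s (+) f (step v i))).
  have := bf v; rewrite /s.
  case: (c i0) (c i1) (c i2) => [] [] [];
  by case: (f (step v i0)) (f (step v i1)) (f (step v i2)) => [] [] [].
exists (m * l); first exact: groupM.
apply: (cover_acts_locally _ _ _ (p := p)) => // d.
rewrite (encodedM me lc) mul1g perm1; congr (_, _ (+) _).
by rewrite addbAC addbb.
Qed.

Lemma cover_universal0 h f (h_inj : injective h) :
  (forall v i, h (step v i) = step (h v) i) -> balanced f ->
  cover_perm f h_inj \in universal_set hnbr L.
Proof.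
move=> hs bf.
have := @cover_universal h f h_inj 1 1 (fun=> false) _ (group1 L) (encoded1 lam) bf.
by apply=> v i; rewrite perm1.
Qed.

Let v0 : node * bool := (0%R, false, false).

Let shift_universal w : exists2 g, g \in universal_set hnbr L &
  g v0 = w /\ acts_locally hnbr g v0 1.
Proof.
case: w => [[x b] e].
(* No white vertex is flipped, so the local action at [v0] is trivial; black residues 0 and 1 are
   flipped when [e] holds, which moves [v0] to the right copy. *)
pose phi (b' : bool) n := ~~ b' && (n != 2) && e.
have bphi : balanced (@periodic j phi).
  by apply: periodic_balanced => // -[]; rewrite /phi //=; case: (e).
exists (cover_perm (periodic phi) (@shift_inj _ b x)).
  by apply: cover_universal0 => // v i; apply: shift_step.
split; first by rewrite cover_permE /= /shift; case: (b); rewrite /= ?subr0 ?addr0.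
apply: cover_acts_locally => [i|]; last first.
  apply: encoded_ext (encoded1 lam) => i.
  by rewrite /periodic /step /= /phi.
by rewrite perm1 shift_step.
Qed.

Let turn_universal l : l \in L -> exists2 g, g \in universal_set hnbr L &
  g v0 = v0 /\ acts_locally hnbr g v0 l.
Proof.
move=> Ll; have [p [c lc]] := L_enc Ll.
pose s := c i0 (+) c i1 (+) c i2.
(* On white vertices [phi] cancels the global flip [s] and leaves [c i] at the neighbour of [v0] in
   direction [i]; on black ones it cancels [s] at [v0], and excluding residue 2 keeps it
   balanced. *)
pose phi (b : bool) n := if b then c (inord n) (+) s else (n != 2) && s.
have bphi : balanced (@periodic j phi).
  apply: periodic_balanced => // -[]; rewrite /phi /=; last by case: (s).
  by rewrite /s; case: (c i0) (c i1) (c i2) => [] [] [].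
exists (cover_perm (fun v => s (+) periodic phi v) (@turn_inj _ j_gt1 p)).
  by apply: (cover_universal _ _ Ll) => // v i; apply: turn_step.
split.
  by rewrite cover_permE /turn corner_map0 /= addbb.
apply: (cover_acts_locally _ _ (p := p)) => [i|]; first exact: turn_step.
apply: encoded_ext lc => i.
rewrite /periodic /step /= add0r residue_corner // /phi inord_val.
by rewrite addbC -addbA addbb addbF.
Qed.

(** Elements with trivial local action move [v] to [v0] and [v0] to [w]; a turn about [v0] in
    between supplies [l]. *)
Lemma universal_realize (v w : node * bool) l : l \in L ->
  exists2 g, g \in universal_set hnbr L & g v = w /\ acts_locally hnbr g v l.
Proof.
move=> Ll; have [a Ga [av al]] := shift_universal v.
have [b Gb [bv bl]] := shift_universal w; have [g Gg [gv gl]] := turn_universal Ll.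
have av' : a^-1 v = v0 by rewrite -av permK.
exists (a^-1 * g * b).
  by rewrite !(@groupM _ (universal_group _ _)) // groupV.
split; first by rewrite !permM av' gv bv.
have := acts_locallyV al; rewrite av invg1 => al'.
rewrite -[l]mul1g -[1 * l]mulg1; apply: acts_locallyM.
  by apply: acts_locallyM; rewrite ?av'.
by rewrite permM av' gv.
Qed.

End UniversalElements.

(** * Balanced functions from the Pascal recurrence *)

Lemma iter_mod (T : Type) (f : T -> T) x m n :
  iter m f x = x -> iter (n %% m) f x = iter n f x.
Proof.
move=> fm; rewrite [in RHS](divn_eq n m) addnC iterD; congr (iter _ f _).
by elim: (n %/ m) => // q IHq; rewrite mulSn iterD -IHq.
Qed.

Section PascalCode.

Local Open Scope ring_scope.

Variables (j k : nat).
Hypothesis jE : j = (2 ^ k.+1)%N.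

Local Notation torus := ('Z_(3 * j) * 'Z_j)%type.
Local Notation node := (torus * bool)%type.

Let j_gt1 : (1 < j)%N.
Proof. by rewrite jE -[1%N]/(2 ^ 0)%N ltn_exp2l. Qed.

Let j3_gt1 : (1 < 3 * j)%N.
Proof. by rewrite (leq_trans j_gt1) // leq_pmull. Qed.

(** The operator S + S^2 over F_2, where S is the shift by one. *)
Definition pascal (g : 'Z_(3 * j) -> bool) (u : 'Z_(3 * j)) : bool :=
  g (u - 1) (+) g (u - 2).

(** The Frobenius identity for (S + S^2)^(2^n): at each doubling the two cross terms cancel. *)
Lemma iter_pascal n g u :
  iter (2 ^ n) pascal g u = g (u - (2 ^ n)%:R) (+) g (u - (2 ^ n)%:R *+ 2).
Proof.
elim: n g u => [|n IHn] g u; first by rewrite expn0.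
rewrite expnS mul2n -addnn iterD !IHn natrD mulr2n.
set q := (2 ^ n)%:R.
have -> : u - (q + q) = u - q - q by ring.
have -> : u - (q + q + (q + q)) = u - q - q - q - q by ring.
have -> : u - q - (q + q) = u - q - q - q by ring.
have -> : u - q - q - (q + q) = u - q - q - q - q by ring.
by rewrite addbA addbK.
Qed.

Definition spread (g : 'Z_(3 * j) -> bool) (x : torus) : bool :=
  iter x.2 pascal g x.1.

(** The relation is the recurrence itself; stability after [j] steps carries it from the last row
    back to row 0. *)
Lemma spread_corners g x : iter j pascal g = g ->
  spread g (x + corner j i0) (+) spread g (x + corner j i1)
    (+) spread g (x + corner j i2) = false.
Proof.
move=> gj.
have modj n : iter (n %% (Zp_trunc j).+2) pascal g = iter n pascal g.
  by apply: iter_mod; rewrite (Zp_cast j_gt1).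
case: x => u t; rewrite corner0 addr0 /spread /corner !inordK //= !modj.
rewrite addn0 addn1 iterS /pascal.
have -> : u + 2 - 1 = u + 1 by ring.
have -> : u + 2 - 2 = u by ring.
by rewrite addbC [X in _ (+) X]addbC addbb.
Qed.

(** The colour classes are independent. Negation on black vertices turns x - a_i into a_i - x, so
    both obey the same recurrence. *)
Definition code (g : bool -> 'Z_(3 * j) -> bool) (v : node) : bool :=
  spread (g v.2) (if v.2 then v.1 else - v.1).

Lemma code_balanced g :
  (forall b, iter j pascal (g b) = g b) -> balanced (code g).
Proof.
move=> gj [x []]; rewrite /code /step /= ?opprB.
  by rewrite ![corner j _ - x]addrC spread_corners.
by rewrite spread_corners.
Qed.

Local Notation word := {ffun 'I_(2 * j).-1 -> bool}.

(** The offset by one leaves position 0 empty, which costs one bit but makes [row] vanish at 0. *)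
Definition seed (g : word) (u : 'Z_(3 * j)) : bool :=
  [exists i : 'I_(2 * j).-1, (i.+1 == u :> nat) && g i].

(* [1 + S^j] maps into the kernel of [1 + S^j + S^(2j)], as [S^(3j) = 1] for the
   shift [S]; on seeds vanishing outside [0 < u < 2j] it is injective. *)
Definition row (g : word) (u : 'Z_(3 * j)) : bool :=
  seed g u (+) seed g (u - j%:R).

Let j3 : j%:R *+ 3 = 0 :> 'Z_(3 * j).
Proof. by rewrite -mulrnA [(j * 3)%N]mulnC pchar_Zp. Qed.

(** In (1 + S^j)(S^j + S^(2j)) the terms S^(2j) cancel, and S^(3j) = 1. *)
Lemma row_stable g : iter j pascal (row g) = row g.
Proof.
apply: funext => u.
have := iter_pascal k.+1 (row g) u; rewrite -jE => ->; rewrite /row; move: j3; set q := j%:R => q3.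
have -> : u - q - q = u - q *+ 2 by rewrite mulr2n; ring.
have -> : u - q *+ 2 - q = u.
  by rewrite -addrA -opprD -mulrSr q3 subr0.
by rewrite addbA addbK addbC.
Qed.

Lemma seed_large g (u : 'Z_(3 * j)) : (2 * j <= u)%N -> seed g u = false.
Proof.
move=> ju; apply/negbTE/existsP => -[i /andP[/eqP iu _]]; move: ju.
by rewrite -iu leqNgt -ltn_predRL ltn_ord.
Qed.

Lemma val_natr n : (n < 3 * j)%N -> (n%:R : 'Z_(3 * j)) = n :> nat.
Proof. by move=> n3; rewrite val_Zp_nat // modn_small. Qed.

Lemma seedE g (i : 'I_(2 * j).-1) : seed g (i.+1)%:R = g i.
Proof.
rewrite /seed val_natr.
  apply/existsP/idP => [[i' /andP[/eqP [/ord_inj ->]]] //|gi].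
  by exists i; rewrite eqxx.
have := ltn_ord i; rewrite ltn_predRL => /leq_trans; apply.
by rewrite leq_mul2r orbT.
Qed.

(** A seed is empty at 0, and also at -j = 2j, just beyond its support. *)
Lemma row0 g : row g 0 = false.
Proof.
rewrite /row; have -> : seed g 0 = false by apply/negbTE/existsP => -[i] /andP[].
have -> : 0 - j%:R = (2 * j)%:R :> 'Z_(3 * j).
  by apply/eqP; rewrite subr_eq -natrD -mulSnr pchar_Zp.
by rewrite seed_large // val_natr // ltn_mul2r (ltnW j_gt1).
Qed.

(** The difference of the seeds is invariant under the shift by [j] and vanishes on the last third
    of the cycle, hence everywhere. *)
Lemma row_inj g g' : row g =1 row g' -> g = g'.
Proof.
move=> gg'; pose d u := seed g u (+) seed g' u.
have dj u : d (u + j%:R) = d u.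
  have := gg' (u + j%:R); rewrite /row addrK /d.
  by case: (seed g _) (seed g _) (seed g' _) (seed g' _) => [] [] [] [].
have d0 n : (2 * j <= n < 3 * j)%N -> d n%:R = false.
  by case/andP=> n2 n3; rewrite /d !seed_large ?val_natr.
have dn n : (n < 3 * j)%N -> d n%:R = false.
  move=> n3; have [n2|n2] := leqP (2 * j) n; first by rewrite d0 ?n2.
  rewrite -dj -natrD; have [n1|n1] := leqP j n.
    rewrite d0 // [(3 * j)%N]mulSnr ltn_add2r n2 andbT.
    by rewrite mul2n -addnn leq_add2r.
  rewrite -dj -natrD d0 // -addnA addnn -mul2n leq_addl /=.
  by rewrite [(3 * j)%N]mulSnr addnC ltn_add2l.
apply/ffunP => i; rewrite -!seedE.
have : d (i.+1)%:R = false.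
  apply: dn; have := ltn_ord i; rewrite ltn_predRL => /leq_trans; apply.
  by rewrite leq_mul2r orbT.
by rewrite /d; case: (seed g _) (seed g' _) => [] [].
Qed.

End PascalCode.

(** * Lower bound for the arc stabiliser *)

Section ArcStabiliser.

Variables (Omega : finType) (L : {group {perm Omega}}).
Variables (lam : Omega -> 'I_3 * bool) (j k : nat).
Hypothesis jE : j = (2 ^ k.+1)%N.
Hypothesis L_even : forall c : 'I_3 -> bool,
  c i0 (+) c i1 (+) c i2 = false -> exists2 l, l \in L & encoded_by lam l 1 c.

Local Notation torus := ('Z_(3 * j) * 'Z_j)%type.
Local Notation node := (torus * bool)%type.
Local Notation word := {ffun 'I_(2 * j).-1 -> bool}.

Let node_inj : injective (@id node) := @inj_id node.

Definition code_perm (g : word * word) : {perm node * bool} :=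
  cover_perm (code (fun b => row (if b then g.1 else g.2))) node_inj.

(** The flips at second coordinate 0 are the two rows themselves, up to the sign on black
    vertices. *)
Lemma code_perm_inj : injective code_perm.
Proof.
move=> [g1 g2] [h1 h2] /permP gh; congr pair; apply: (row_inj jE) => u.
  have := gh ((u, 0%R), true, false); rewrite !cover_permE => /(congr1 snd) /=.
  by rewrite /code /spread.
have codeN f (x : torus) : code f (- x, false)%R = spread (f false) x.
  by rewrite /code /= opprK.
have := congr1 snd (gh (- (u, 0), false, false))%R.
by rewrite !cover_permE [LHS]codeN [RHS]codeN.
Qed.

Lemma code_perm_universal g : code_perm g \in universal_set (@hnbr _ lam j) L.
Proof.
apply: cover_universal0 => //.
by apply: (code_balanced jE) => b; apply: (row_stable jE).
Qed.

Lemma code_perm_fix g (w : node * bool) : w.1.1 = 0%R -> code_perm g w = w.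
Proof.
case: w => [[x b] e] /= ->; rewrite cover_permE /= /code /= oppr0 if_same.
by rewrite /spread /= (row0 jE) addbF.
Qed.

Lemma card_arc_stabiliser (G : {group {perm node * bool}}) (v w : node * bool) :
  G = universal_set (@hnbr _ lam j) L :> {set _} ->
  v.1.1 = 0%R -> w.1.1 = 0%R ->
  (4 ^ (2 * j).-1)%N <= #|'C_G[v | 'P] :&: 'C_G[w | 'P]|.
Proof.
move=> GE v0 w0; have <- : #|{: word * word}| = (4 ^ (2 * j).-1)%N.
  by rewrite card_prod card_ffun card_bool card_ord -expnMn.
rewrite -(card_codom code_perm_inj); apply/subset_leq_card/subsetP => _ /codomP[g ->].
by rewrite !inE GE code_perm_universal !sub1set !inE /= /aperm !code_perm_fix ?eqxx.
Qed.

End ArcStabiliser.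

Theorem theorem5p1 (R : realType) (Omega : finType) (L : {group {perm Omega}})
    (hdeg : #|Omega| = 6)
    (htrans : [transitive L, on [set: Omega] | 'P]%g)
    (himprim : ~~ [primitive L, on [set: Omega] | 'P]%g)
    (hno2 : ~ exists Q : {set {set Omega}},
        imprimitivity_system L [set: Omega] 'P Q /\ #|Q| = 2) :
  graph_unrestrictive
    (fun n : nat => 4 `^ (Num.sqrt (n%:R / 3) - 1) : R)%R L.
Proof.
have [lam [lam_bij L_enc L_even]] :=
  imprimitive_coordinates hdeg htrans himprim hno2.
(* The exponent [n.+1] ensures both [1 < j] and [n < j]. *)
move=> n; pose j := (2 ^ n.+1)%N.
have j_gt1 : 1 < j by rewrite -[1%N]/(2 ^ 0)%N ltn_exp2l.
pose Gam := honeycomb j; pose G := universal_group (@hnbr _ lam j) L.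
exists Gam, G; split.
- apply: universal_is_locally => //.
  + by move=> w; apply: hnbr_inj.
  + by move=> v w; apply: (hadjE lam_bij).
  + by move=> v w l; apply: universal_realize.
- rewrite card_honeycomb //; apply: leq_trans (leq_pmull _ _) => //.
  rewrite -mulnn; apply: leq_trans (leq_pmull _ _); last exact: ltnW.
  exact/ltnW/ltnW/ltn_expl.
(* The arc runs from black 0 to white 0 in direction 0, where all rows vanish. *)
exists (0%R, false, false), (0%R, true, false); split.
  by apply/existsP; exists i0; rewrite /step /= corner0 addr0.
apply: (@le_trans _ _ (4 ^ (2 * j).-1)%:R%R); last first.
  by rewrite ler_nat; apply: (card_arc_stabiliser (erefl j) L_even).
rewrite card_honeycomb //.
have -> : ((12 * j ^ 2)%:R / 3 = (2 * j)%:R ^+ 2 :> R)%R.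
  by rewrite !natrM natrX; field.
rewrite sqrtr_sqr ger0_norm ?ler0n // natrX.
have -> : ((2 * j)%:R - 1 = (2 * j).-1%:R :> R)%R.
  by rewrite -subn1 natrB // muln_gt0 (ltnW j_gt1).
by rewrite powR_mulrn ?ler0n.
Qed.
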